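(* Suppose that $E\subset\mathbb{R}$ is a measurable set and for some fixed $r_0>0$ we have $$\sum_{n=1}^{\infty}\int_{E^c\cap[0,r_0^n]}\frac{1}{n}x^{\frac1n-1}\,d\lambda(x)<\infty,$$ where $E^c=\mathbb{R}\setminus E$ denotes the complement of $E$. Then there exist $a>0$ and $r\in(0,1)$ such that $ar^n\in E$ for all $n\in\mathbb{N}$.
   Context: $\lambda$ denotes Lebesgue measure on $\mathbb{R}$, and ''measurable'' means Lebesgue measurable. *)

(* Defs.v *)
From HB Require Import structures.
From mathcomp Require Import all_boot all_order all_algebra.
From mathcomp Require Import all_classical all_reals all_analysis.

Set Implicit Arguments.
Unset Strict Implicit.
Unset Printing Implicit Defensive.

Import Order.TTheory GRing.Theory Num.Theory.
Import numFieldNormedType.Exports.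

Local Open Scope classical_set_scope.
Local Open Scope ring_scope.

(* The domain sigma-algebra of [completed_lebesgue_measure], i.e. the
   Caratheodory-measurable sets of the Lebesgue outer measure.  Plain
   [measurable] on [R] would only give the Borel sets. *)
Definition lebesgue_measurable (R : realType) (E : set R) : Prop :=
  ((@wlength R idfun)^*)%mu.-cara.-measurable E.

(* Main.v *)
Require Import Defs.
From HB Require Import structures.
From mathcomp Require Import all_boot all_order all_algebra.
From mathcomp Require Import all_classical all_reals all_analysis.
From mathcomp Require Import measurable_realfun.

Set Implicit Arguments.
Unset Strict Implicit.
Unset Printing Implicit Defensive.

Import Order.TTheory GRing.Theory Num.Theory.
Import numFieldNormedType.Exports.

Local Open Scope classical_set_scope.
Local Open Scope ring_scope.

(** The density n^-1 x^(n^-1 - 1) is the derivative of the n-th root, so the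
    substitution x = s^n turns the n-th integral of the series into the Lebesgue
    measure of the set of those s in [0, r0] for which s^n lies outside E. The
    series of these measures converges; by the Borel-Cantelli lemma almost
    every s in [0, r0] satisfies s^n \in E for all large n. Any such s in
    ]0, 1[ gives the geometric progression: if s^n \in E for n > N, take
    a = s^(N+1) and r = s.

    The substitution has to be made over a measurable set
    ([lebesgue_preimage_exprn]). Both sides are finite measures as functions of
    that set, and on rays ]-oo, u[ they agree by the fundamental theorem of
    calculus ([integral_powR_derive]), hence they agree on Borel sets. It is
    enough to work on an interval ]c, d[ with 0 < c, which keeps away from the
    singularity of the density at 0.

    A Lebesgue measurable E is replaced by a Borel subset differing from it by
    a null set ([measurable_borel_minus_null]), and integrals of Borel functions
    for the completed measure are brought back to Lebesgue measure on Borel sets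
    ([integral_completed]). *)

Section lebesgue_substitution.
Context {R : realType}.
Local Notation mu := (@lebesgue_measure R).
Local Notation cmu := (@completed_lebesgue_measure R).

(** The Caratheodory sigma-algebra of the Lebesgue outer measure is the
    completion of the Borel one, so E is the union of a Borel set A and of a
    subset of a Borel null set B. *)
Lemma measurable_borel_minus_null (E : set R) : lebesgue_measurable E ->
  exists A B : set R, [/\ measurable A, measurable B, mu B = 0%E,
    A `<=` E & E `<=` A `|` B].
Proof.
rewrite /lebesgue_measurable -completed_caratheodory_measurable.
rewrite g_sigma_completed_algebra_genE => -[A mA [N [B [mB B0 NB]]] <-].
exists A, B; split => //; exact: setUS.
Qed.

Lemma integral_powR_derive (a p q : R) : 0 < p -> p < q ->
  (\int[mu]_(x in `[p, q]) (a * x `^ (a - 1))%:E = (q `^ a - p `^ a)%:E)%E.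
Proof.
move=> p0 pq.
have pos x : x \in `[p, q] -> 0 < x.
  by rewrite in_itv/= => /andP[px _]; exact: lt_le_trans px.
have cpow b x : 0 < x -> {for x, continuous (fun y : R => y `^ b)}.
  by move=> x0; apply/differentiable_continuous/derivable1_diffP/derivable_powR;
    rewrite in_itv/= andbT.
rewrite (@continuous_FTC2 _ _ (fun x => x `^ a))//.
- apply/continuous_in_subspaceT => x /[!inE]/= xpq.
  by apply: cvgM; [exact: cvg_cst|exact/cpow/pos].
- split.
  + move=> x xpq; apply: ex_derive; apply: is_derive1_powR.
    by apply: pos; exact: subset_itv_oo_cc.
  + by apply: cvg_at_right_filter; exact: cpow.
  + by apply: cvg_at_left_filter; apply: cpow; exact: lt_trans pq.
- move=> x xpq; rewrite powR_derive1// in_itv/= andbT pos//.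
  exact: subset_itv_oo_cc.
Qed.

Lemma measurable_powR_density (a : R) (D : set R) :
  measurable_fun D (EFin \o (fun x : R => a * x `^ (a - 1))).
Proof.
by apply/measurable_EFinP; apply: measurable_funM => //; exact: measurable_funTS.
Qed.

(** The identity, from the completed measurable space to the Borel one, is the
    map along which integrals are transferred below. *)
Lemma measurable_idfun_completed : measurable_fun setT
  (idfun : caratheodory_type (@wlength R idfun)^*%mu -> measurableTypeR R).
Proof.
by move=> _ A mA; rewrite setTI preimage_id; exact: sub_caratheodory.
Qed.

(** Lebesgue measure on Borel sets is the image of the completed measure under
    the identity, so this is the integration formula for image measures. *)
Lemma integral_completed (D : set R) (f : R -> \bar R) :
  measurable D -> measurable_fun D f -> (forall x, D x -> (0 <= f x)%E) ->
  (\int[cmu]_(x in D) f x = \int[mu]_(x in D) f x)%E.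
Proof.
move=> mD mf f0.
have := @ge0_integral_pushforward _ _ _ _ R _ measurable_idfun_completed cmu
  D f mD mf.
rewrite preimage_id => <-//.
by move=> x /[!inE]; exact: f0.
Qed.

Lemma powRVnK n (q : R) : (0 < n)%N -> 0 <= q -> (q `^ n%:R^-1) ^+ n = q.
Proof.
move=> n0 q0.
by rewrite -powR_mulrn ?powR_ge0// -powRrM mulVf ?powRr1// pnatr_eq0 -lt0n.
Qed.

Lemma exprnVK n (q : R) : (0 < n)%N -> 0 <= q -> (q ^+ n) `^ n%:R^-1 = q.
Proof.
move=> n0 q0; rewrite -powR_mulrn// -powRrM mulfV ?powRr1//.
by rewrite pnatr_eq0 -lt0n.
Qed.

Section density.
Variables (f : R -> \bar R)
  (mf : measurable_fun setT f)
  (f0 : forall x, (0 <= f x)%E).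

(** The proofs are arguments so that the measure structure declared below can be
    inferred from the term alone. *)
Definition density_measure of measurable_fun setT f &
  (forall x, (0 <= f x)%E) := fun A : set R => (\int[mu]_(x in A) f x)%E.

Let density0 : density_measure mf f0 set0 = 0%E.
Proof. exact: integral_set0. Qed.

Let density_ge0 A : (0 <= density_measure mf f0 A)%E.
Proof. by apply: integral_ge0 => x _; exact: f0. Qed.

Let density_sigma_additive : semi_sigma_additive (density_measure mf f0).
Proof. by have := @semi_sigma_additive_nng_induced _ _ _ mu f mf f0. Qed.

HB.instance Definition _ := isMeasure.Build _ _ _ (density_measure mf f0)
  density0 density_ge0 density_sigma_additive.
End density.

(** Substitution x = s^n over a Borel set A. Both sides are finite measures in
    A, so it is enough to compare them on the rays A = ]-oo, u[. There, with
    q = min u (d^n), the integral runs over ]c^n, q[ and the preimage is the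
    interval from c to the n-th root of q, or both sets are empty when
    q <= c^n. *)
Lemma lebesgue_preimage_exprn (n : nat) (c d : R) (A : set R) :
  (0 < n)%N -> 0 < c -> c < d -> measurable A ->
  (mu ((fun s => (s ^+ n)%R) @^-1` A `&` `]c, d[) =
   \int[mu]_(x in A `&` `](c ^+ n)%R, (d ^+ n)%R[)
     (n%:R^-1 * x `^ (n%:R^-1 - 1))%:E)%E.
Proof.
move=> n0 c0 cd.
pose f x := (n%:R^-1 * x `^ (n%:R^-1 - 1) : R)%:E.
have mf : measurable_fun setT f by exact: measurable_powR_density.
have f0 x : (0 <= f x)%E by rewrite lee_fin mulr_ge0 ?invr_ge0 ?powR_ge0.
have mX : measurable_fun setT (fun s : R => s ^+ n) by exact: exprn_measurable.
have mI (a b : R) : measurable (`]a, b[%classic : set R).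
  exact: measurable_itv.
have [m1 m1E] : exists m : {measure set R -> \bar R},
    forall A, m A = mu ((fun s => s ^+ n) @^-1` A `&` `]c, d[).
  by eexists (pushforward (mrestr mu (mI c d)) ((fun s => s ^+ n) : R -> R)).
have [m2 m2E] : exists m : {measure set R -> \bar R},
    forall A, m A = (\int[mu]_(x in A `&` `](c ^+ n)%R, (d ^+ n)%R[) f x)%E.
  by exists (mrestr (density_measure mf f0) (mI (c ^+ n) (d ^+ n))).
move=> mA; rewrite -m1E -(m2E A).
apply: (measure_unique (@RGenInftyO.G R) (fun k => `]-oo, k%:R[%classic)) => //.
- exact: RGenInftyO.measurableE.
- move=> _ _ [x ->] [y ->]; exists (Num.min x y).
  apply/seteqP; split => z /=; rewrite !in_itv/= lt_min.
    by move=> [-> ->].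
  by move=> /andP[].
- by move=> k; exists k%:R.
- apply/seteqP; split => // x _; exists (Num.truncn `|x|).+1 => //=.
  rewrite in_itv/=; apply: (le_lt_trans (ler_norm x)).
  exact: truncnS_gt.
- move=> _ [u ->]; rewrite m1E m2E.
  have cn0 : 0 < c ^+ n by rewrite exprn_gt0.
  set q := Num.min u (d ^+ n).
  have -> : `]-oo, u[ `&` `]c ^+ n, d ^+ n[ = `]c ^+ n, q[%classic.
    apply/seteqP; split => x /=; rewrite !in_itv/= lt_min.
      by move=> [-> /andP[-> ->]].
    by move=> /and3P[-> -> ->].
  have -> : (fun s => s ^+ n) @^-1` `]-oo, u[ `&` `]c, d[ =
            [set s | [/\ 0 < s, c ^+ n < s ^+ n & s ^+ n < q]].
    apply/seteqP; split => s /=; rewrite !in_itv/= lt_min.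
      move=> [-> /andP[cs sd]]; have s0 := lt_trans c0 cs.
      have d0 := lt_trans s0 sd.
      by rewrite !ltr_pXn2r// ?nnegrE ltW.
    move=> [s0 cs /andP[-> sd]]; split => //; move: cs sd.
    have d0 := lt_trans c0 cd.
    by rewrite !ltr_pXn2r ?nnegrE ?ltW// => -> ->.
  have [qc|cq] := leP q (c ^+ n).
    rewrite set_itv_ge ?bnd_simp -?leNgt// integral_set0.
    rewrite (_ : [set s | _] = set0) ?measure0//.
    apply/seteqP; split => s //= [_ cs] /(lt_trans cs).
    by rewrite ltNge qc.
  have q0 := lt_trans cn0 cq.
  have r0 : 0 < q `^ n%:R^-1 by exact: powR_gt0.
  have -> : [set s | [/\ 0 < s, c ^+ n < s ^+ n & s ^+ n < q]] =
            `]c, (q `^ n%:R^-1)[%classic.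
    rewrite -{1}(powRVnK n0 (ltW q0)).
    apply/seteqP; split => s /=; rewrite in_itv/=.
      by move=> [s0]; rewrite !ltr_pXn2r ?nnegrE ?ltW// => -> ->.
    move=> /andP[cs sq]; have s0 := lt_trans c0 cs.
    by rewrite !ltr_pXn2r ?nnegrE ?ltW.
  rewrite lebesgue_measure_itv/= lte_fin.
  have -> : c < q `^ n%:R^-1.
    by rewrite -(ltr_pXn2r n0) ?nnegrE ?ltW// powRVnK// ltW.
  rewrite -(integral_itv_bndoo true false); last exact: measurable_funTS.
  by rewrite integral_powR_derive// exprnVK// ltW.
- move=> k; rewrite m1E.
  apply: (@le_lt_trans _ _ (mu `]c, d[)).
    apply: le_measure; rewrite ?inE; last exact: subIsetr.
    + by apply: measurableI => //; rewrite -[X in measurable X]setTI; exact: mX.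
    + exact: measurable_itv.
  by rewrite lebesgue_measure_itv/=; case: ifP => // _; exact: ltry.
Unshelve. exact: mX.
Qed.
End lebesgue_substitution.

Theorem proposition3p1 (R : realType) (E : set R) (mE : lebesgue_measurable E)
    (r0 : R) (r0_gt0 : 0 < r0)
    (sum_fin : (\sum_(1 <= n <oo)
       \int[@completed_lebesgue_measure R]_(x in ~` E `&` `[0%R, (r0 ^+ n)%R])
         (n%:R^-1 * x `^ (n%:R^-1 - 1))%:E < +oo)%E) :
  exists a r : R, 0 < a /\ 0 < r < 1 /\ forall n : nat, E (a * r ^+ n).
Proof.
have [A [B [mA mB B0 AE EAB]]] := measurable_borel_minus_null mE.
(* The bound r0 makes the hypothesis apply on ]c, d[; the bound 1/2 puts the
   ratio found there below 1. *)
pose d : R := Num.min r0 2^-1; pose c := d / 2.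
have d0 : 0 < d by rewrite lt_min r0_gt0 invr_gt0 ltr0n.
have c0 : 0 < c by exact: divr_gt0.
have cd : c < d by rewrite ltr_pdivrMr// ltr_pMr// ltr1n.
pose S n := (fun s : R => s ^+ n.+1) @^-1` (~` A) `&` `]c, d[.
have mS n : measurable (S n).
  apply: measurableI; last exact: measurable_itv.
  rewrite -[X in measurable X]setTI; apply: exprn_measurable => //.
  exact: measurableC.
(* Exceptional sets: ~` A exceeds ~` E only inside the null set B, which can be
   removed from the domain once the substitution is made. *)
have leS n : (lebesgue_measure (S n) <=
    \int[@completed_lebesgue_measure R]_(x in ~` E `&` `[0%R, (r0 ^+ n.+1)%R])
         (n.+1%:R^-1 * x `^ (n.+1%:R^-1 - 1))%:E)%E.
  have f0 (x : R) : (0 <= (n.+1%:R^-1 * x `^ (n.+1%:R^-1 - 1))%:E)%E.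
    by rewrite lee_fin mulr_ge0 ?invr_ge0 ?powR_ge0.
  rewrite lebesgue_preimage_exprn//; last exact: measurableC.
  set J := `](c ^+ n.+1), (d ^+ n.+1)[%classic.
  have mAJ : measurable (~` A `&` J).
    by apply: measurableI; [exact: measurableC|exact: measurable_itv].
  rewrite (@ge0_negligible_integral _ _ _ lebesgue_measure (~` A `&` J) B)//;
    last exact: measurable_powR_density.
  have mD : measurable ((~` A `&` J) `\` B) by exact: measurableD.
  rewrite -integral_completed//; last exact: measurable_powR_density.
  apply: ge0_subset_integral.
  - exact: sub_caratheodory.
  - apply: measurableI; first exact: measurableC.
    by apply: sub_caratheodory; exact: measurable_itv.
  - have := measurableT_comp
      (@measurable_powR_density R n.+1%:R^-1 setT)
      (@measurable_idfun_completed R).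
    exact: measurable_funTS.
  - by move=> x _.
  - move=> x [[nA]]; rewrite /J/= !in_itv/= => /andP[cx xd] nB; split.
      by move=> /EAB[].
    apply/andP; split.
      by apply: le_trans (ltW cx); rewrite exprn_ge0// ltW.
    apply: (le_trans (ltW xd)).
    rewrite lerXn2r ?nnegrE ?(ltW d0) ?(ltW r0_gt0)//.
    by rewrite ge_min lexx.
have limS0 : lebesgue_measure (lim_sup_set S) = 0%E.
  apply: lim_sup_set_cvg0 => //.
  apply: le_lt_trans sum_fin.
  rewrite -[leRHS](nneseries_addn 1).
    apply: lee_nneseries => // n _.
    by rewrite addn1; exact: leS.
  move=> n; apply: integral_ge0 => x _.
  by rewrite lee_fin mulr_ge0 ?invr_ge0 ?powR_ge0.
(* A null set cannot contain the whole interval. *)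
have [s scd nS] : exists2 s, s \in `]c, d[ & ~ lim_sup_set S s.
  apply: contrapT => h.
  have cdS : `]c, d[ `<=` lim_sup_set S.
    by move=> s scd; apply: contrapT => nS; apply: h; exists s.
  have : (lebesgue_measure (`]c, d[ : set R) <=
          lebesgue_measure (lim_sup_set S))%E.
    apply: le_measure; rewrite ?inE//.
    apply: bigcap_measurable => // k _.
    by apply: bigcup_measurable => j _; exact: mS.
  rewrite limS0 lebesgue_measure_itv/= lte_fin cd -EFinB lee_fin.
  by rewrite leNgt subr_gt0 cd.
have [N SN] : exists N, forall n, (N <= n)%N -> ~ S n s.
  apply: contrapT => h; apply: nS => N _; apply: contrapT => SN.
  by apply: h; exists N => n Nn Sn; apply: SN; exists n.
move: (scd); rewrite in_itv/= => /andP[cs sd].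
have s0 := lt_trans c0 cs.
exists (s ^+ N.+1), s; rewrite exprn_gt0// s0; split => //; split.
  apply: (lt_trans sd); rewrite gt_min.
  by rewrite invf_lt1 ?ltr1n ?orbT.
move=> n; rewrite -exprD addSn; apply: AE; apply: contrapT => nA.
by apply: (SN (N + n)%N (leq_addr _ _)); split.
Qed.
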